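(* Let $n,d$ be positive integers and let $f_1,\dots,f_n:\mathbb{R}^d\to\mathbb{R}$ be twice continuously differentiable functions for which there are constants $0<\mu\le L<\infty$ with $\mu I\preceq \nabla^2 f_i(x)\preceq L I$ for all $x\in\mathbb{R}^d$ and all $i=1,\dots,n$. Let $\mathcal{G}=(\mathcal{V},\mathcal{E})$ be a connected, undirected, simple graph (no self-loops, no multiple edges) with $\mathcal{V}=\{1,\dots,n\}$. Let $W=W^T\in\mathbb{R}^{n\times n}$ be a doubly stochastic matrix with entries $w_{ij}$ such that $w_{ij}>0$ if $\{i,j\}\in\mathcal{E}$; $w_{ij}=0$ if $\{i,j\}\notin\mathcal{E}$ and $i\ne j$; $w_{ii}=1-\sum_{j\in O_i}w_{ij}$, where $O_i=\{j:\{i,j\}\in\mathcal{E}\}$; and $0<w_{\min}\le w_{ii}\le w_{\max}<1$ for all $i$, for some constants $w_{\min},w_{\max}$. Then there exist $0<\sigma_{\min}<\sigma_{\max}$ such that the sequence $\{x^k\}_{k\in\mathbb{N}}\subset\mathbb{R}^{nd}$ generated by the Distributed Spectral Gradient (DSG) method (defined in the context) with safeguarding parameters $\sigma_{\min},\sigma_{\max}$ converges R-linearly to the solution of the problem of minimizing $f(y)=\sum_{i=1}^n f_i(y)$ over $y\in\mathbb{R}^d$; that is, $x^k$ converges R-linearly to $x^*=\mathbf{1}\otimes y^*=((y^* )^T,\dots,(y^* )^T)^T\in\mathbb{R}^{nd}$, where $y^*$ is the unique minimizer of $f$.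
   Context: Notation. A vector $x\in\mathbb{R}^{nd}$ is written in blocks $x=(x_1^T,\dots,x_n^T)^T$ with $x_i\in\mathbb{R}^d$. Define $F:\mathbb{R}^{nd}\to\mathbb{R}$ by $F(x)=\sum_{i=1}^n f_i(x_i)$, so that $\nabla F(x)=(\nabla f_1(x_1)^T,\dots,\nabla f_n(x_n)^T)^T$. Let $\mathcal{W}=W\otimes I$ (Kronecker product with the $d\times d$ identity $I$), let $\mathcal{I}$ be the $nd\times nd$ identity matrix, and let $\mathbf{1}\in\mathbb{R}^n$ be the all-ones vector. For symmetric matrices, $P\preceq Q$ means that $Q-P$ is positive semidefinite. For node $i$, $\bar O_i=O_i\cup\{i\}$. $\mathcal{P}_{[a,b]}$ denotes the projection of a real number onto the interval $[a,b]$. DSG method with safeguarding parameters $0<\sigma_{\min}<\sigma_{\max}<\infty$. Start from an arbitrary $x^0\in\mathbb{R}^{nd}$ and $u^0=0\in\mathbb{R}^{nd}$. For $k=0,1,2,\dots$ set $$x^{k+1}=\mathcal{W}x^k-\Sigma_k^{-1}\left(\nabla F(x^k)+u^k\right),\qquad u^{k+1}=\mathcal{W}u^k+(\mathcal{W}-\mathcal{I})\nabla F(x^k),$$ where $\Sigma_k=\mathrm{diag}(\sigma_1^k I,\dots,\sigma_n^k I)\in\mathbb{R}^{nd\times nd}$. All the inverse step-sizes $\sigma_i^k$ lie in $[\sigma_{\min},\sigma_{\max}]$, and they are given, for $k\ge 1$, by $$\sigma_i^k=\mathcal{P}_{[\sigma_{\min},\sigma_{\max}]}\left\{\frac{(s_i^{k-1})^T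 y_i^{k-1}}{(s_i^{k-1})^T s_i^{k-1}}+\sum_{j\in\bar O_i}w_{ij}\left(1-\frac{(s_i^{k-1})^T y_j^{k-1}}{(s_i^{k-1})^T s_i^{k-1}}\right)\right\},$$ with $s_i^{k-1}=x_i^k-x_i^{k-1}$ and $y_i^{k-1}=\nabla f_i(x_i^k)-\nabla f_i(x_i^{k-1})$. R-linear convergence of $x^k$ to $x^*$ means that there exist $C>0$ and $\delta\in(0,1)$ with $\|x^k-x^*\|\le C\delta^k$ for all $k\ge 0$. *)

(* Defs.v *)
From mathcomp Require Export all_boot all_order all_algebra.
From mathcomp Require Export all_classical all_reals all_analysis.
Set Implicit Arguments.
Unset Strict Implicit.
Unset Printing Implicit Defensive.
Import Order.TTheory GRing.Theory Num.Theory.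
Import numFieldNormedType.Exports.
Local Open Scope ring_scope.

Section Euclidean.
Context {R : realType} {m : nat}.
Implicit Types (x y : 'cV[R]_m) (A B : 'M[R]_m).

Definition dotv x y : R := (x^T *m y) 0 0.

(* The library norm `|x| on matrices is the max norm. *)
Definition enorm x : R := Num.sqrt (dotv x x).

Definition psdmx A : Prop := forall v : 'cV[R]_m, 0 <= dotv v (A *m v).

(* Only meant for symmetric matrices; Hessians of C2 functions are symmetric. *)
Definition lownerle A B : Prop := psdmx (B - A).

Definition basisv (i : 'I_m) : 'cV[R]_m := delta_mx i 0.

Definition grad (g : 'cV[R]_m -> R) x : 'cV[R]_m := \col_i 'D_(basisv i) g x.

Definition hess (g : 'cV[R]_m -> R) x : 'M[R]_m :=
  \matrix_(i, j) 'D_(basisv j) (fun z => grad g z i 0) x.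

Definition C2 (g : 'cV[R]_m -> R) : Prop :=
  [/\ forall x, differentiable g x,
      forall x, differentiable (grad g) x
    & continuous (hess g)].

Definition minimizer (g : 'cV[R]_m -> R) y : Prop := forall z, g y <= g z.

Definition R_linear_cvg (x : nat -> 'cV[R]_m) (xs : 'cV[R]_m) : Prop :=
  exists C delta : R, [/\ 0 < C, 0 < delta < 1 &
    forall k, enorm (x k - xs) <= C * delta ^+ k].

End Euclidean.

Definition proj_itv {R : realType} (a b t : R) : R := Num.max a (Num.min b t).

Definition doubly_stochastic {R : realType} {n : nat} (W : 'M[R]_n) : Prop :=
  [/\ forall i j, 0 <= W i j, forall i, \sum_j W i j = 1
    & forall j, \sum_i W i j = 1].

Definition neighbors {n : nat} (e : rel 'I_n) (i : 'I_n) : {set 'I_n} :=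
  [set j | e i j].

Definition closed_neighbors {n : nat} (e : rel 'I_n) (i : 'I_n) : {set 'I_n} :=
  i |: neighbors e i.

Definition kronmx {R : realType} {m n p q : nat}
    (A : 'M[R]_(m, n)) (B : 'M[R]_(p, q)) :
    'M[R]_(\sum_(i < m) p, \sum_(j < n) q) :=
  \mxblock_(i < m, j < n) (A i j *: B).

(* A vector of R^(nd) has type 'cV_(\sum_(i < n) d), so that the library's
   block operations apply: its i-th block, of size d, is submxcol x i. *)
Definition blk {R : realType} {n d : nat} (x : 'cV[R]_(\sum_(i < n) d))
    (i : 'I_n) : 'cV[R]_d := submxcol x i.

Section DSG.
Context {R : realType} {n d : nat}.
Variables (f : 'I_n -> 'cV[R]_d -> R) (e : rel 'I_n) (W : 'M[R]_n).
Variables (smin smax : R).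

Definition separable_sum (x : 'cV[R]_(\sum_(i < n) d)) : R :=
  \sum_(i < n) f i (blk x i).

(* 1 (x) y *)
Definition replicate (y : 'cV[R]_d) : 'cV[R]_(\sum_(i < n) d) :=
  \mxcol_(i < n) y.

Definition step_mx (sigma : 'I_n -> R) : 'M[R]_(\sum_(i < n) d) :=
  \mxdiag_(i < n) ((sigma i)%:M : 'M[R]_d).

Definition sdiff (x : nat -> 'cV[R]_(\sum_(i < n) d)) (k : nat) (i : 'I_n) :
  'cV[R]_d := blk (x k.+1) i - blk (x k) i.

Definition ydiff (x : nat -> 'cV[R]_(\sum_(i < n) d)) (k : nat) (i : 'I_n) :
  'cV[R]_d := grad (f i) (blk (x k.+1) i) - grad (f i) (blk (x k) i).

Definition spectral_step (x : nat -> 'cV[R]_(\sum_(i < n) d)) (k : nat)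
    (i : 'I_n) : R :=
  let s := sdiff x k i in
  proj_itv smin smax
    (dotv s (ydiff x k i) / dotv s s
     + \sum_(j in closed_neighbors e i)
         W i j * (1 - dotv s (ydiff x k j) / dotv s s)).

(* x^0 and the sigma_i^0 are arbitrary.  The spectral formula is the quotient
   0/0 when s_i = 0; in that case sigma_i is left arbitrary in [smin, smax]. *)
Record DSG (x u : nat -> 'cV[R]_(\sum_(i < n) d)) (sigma : nat -> 'I_n -> R) :
  Prop := {
  DSG_u0 : u 0%N = 0;
  DSG_x : forall k, x k.+1 = kronmx W 1%:M *m x k
    - invmx (step_mx (sigma k)) *m (grad separable_sum (x k) + u k);
  DSG_u : forall k, u k.+1 = kronmx W 1%:M *m u k
    + (kronmx W 1%:M - 1%:M) *m grad separable_sum (x k);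
  DSG_safeguard : forall k i, smin <= sigma k i <= smax;
  DSG_sigma : forall k i, sdiff x k i != 0 ->
    sigma k.+1 i = spectral_step x k i
}.

End DSG.

(* Main.v *)
Require Import Defs.
From mathcomp Require Import all_boot all_order all_algebra.
From mathcomp Require Import all_classical all_reals all_analysis.
From mathcomp Require Import ring lra.
Import Order.TTheory GRing.Theory Num.Theory.
Import numFieldNormedType.Exports.
Local Open Scope ring_scope.

(** With y^k = grad F(x^k) + u^k the method is gradient tracking:
    x^{k+1} = W x^k - Sigma_k^{-1} y^k,
    y^{k+1} = W y^k + grad F(x^{k+1}) - grad F(x^k),
    and the mean of the y_i^k is always the mean of the grad f_i(x_i^k).
    Since smin and smax may be chosen, take smin = 1/alpha and
    smax = (1 + eps)/alpha: whatever the spectral formula returns, the steps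
    are relative eps-perturbations of the constant step alpha.
    The optimality error of the mean, the consensus error of x and the
    consensus error of y then satisfy a coupled linear system of inequalities,
    and a weighted sum of them contracts by a fixed factor once the weights,
    then eps, then alpha are chosen suitably (small gain).  Gradients enter
    only through strong monotonicity and Lipschitz continuity, and W only
    through its contraction on mean-zero vectors.

    A vector of R^(nd) is handled as the d x n matrix of its blocks, so that
    W (x) I acts as right multiplication by W. *)

Set Implicit Arguments.
Unset Strict Implicit.
Unset Printing Implicit Defensive.

(** * Frobenius norm *)

Section Frobenius.
Context {R : realType} {m n : nat}.
Implicit Types (A B C : 'M[R]_(m, n)) (M : 'M[R]_n).

Definition fdot A B : R := \tr (A^T *m B).

Definition fnorm A : R := Num.sqrt (fdot A A).

Lemma fdotC A B : fdot A B = fdot B A.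
Proof. by rewrite /fdot -mxtrace_tr trmx_mul trmxK. Qed.

Lemma fdotDl A B C : fdot (A + B) C = fdot A C + fdot B C.
Proof. by rewrite /fdot linearD mulmxDl linearD. Qed.

Lemma fdotZl (a : R) A B : fdot (a *: A) B = a * fdot A B.
Proof. by rewrite /fdot linearZ -scalemxAl linearZ. Qed.

Lemma fdotNl A B : fdot (- A) B = - fdot A B.
Proof. by rewrite -scaleN1r fdotZl mulN1r. Qed.

Lemma fdotBl A B C : fdot (A - B) C = fdot A C - fdot B C.
Proof. by rewrite fdotDl fdotNl. Qed.

Lemma fdotDr A B C : fdot A (B + C) = fdot A B + fdot A C.
Proof. by rewrite !(fdotC A) fdotDl. Qed.

Lemma fdotZr (a : R) A B : fdot A (a *: B) = a * fdot A B.
Proof. by rewrite !(fdotC A) fdotZl. Qed.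

Lemma fdotNr A B : fdot A (- B) = - fdot A B.
Proof. by rewrite !(fdotC A) fdotNl. Qed.

Lemma fdotBr A B C : fdot A (B - C) = fdot A B - fdot A C.
Proof. by rewrite !(fdotC A) fdotBl. Qed.

Definition fdotE := (fdotDl, fdotDr, fdotNl, fdotNr, fdotZl, fdotZr).

Lemma fdot_mulmxl A M B : fdot (A *m M) B = fdot A (B *m M^T).
Proof. by rewrite /fdot trmx_mul -mulmxA mxtrace_mulC mulmxA. Qed.

Lemma fdot0l B : fdot 0 B = 0.
Proof. by rewrite /fdot trmx0 mul0mx linear0. Qed.

Lemma fdot_sum A B : fdot A B = \sum_i \sum_j A i j * B i j.
Proof.
rewrite exchange_big; apply: eq_bigr => j _.
by rewrite mxE; apply: eq_bigr => i _; rewrite mxE.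
Qed.

Lemma fdot_ge0 A : 0 <= fdot A A.
Proof.
by rewrite fdot_sum; do 2![apply: sumr_ge0 => ? _]; rewrite -expr2 sqr_ge0.
Qed.

Lemma fdot_eq0 A : (fdot A A == 0) = (A == 0).
Proof.
apply/eqP/eqP => [|->]; last exact: fdot0l.
rewrite fdot_sum => /eqP; rewrite psumr_eq0; last first.
  by move=> i _; apply: sumr_ge0 => ? _; rewrite -expr2 sqr_ge0.
move=> /allP A0; apply/matrixP => i j; rewrite mxE.
have := A0 i (mem_index_enum i); rewrite psumr_eq0 => [/allP/(_ j (mem_index_enum j))|].
  by rewrite -expr2 sqrf_eq0 => /eqP.
by move=> ? _; rewrite -expr2 sqr_ge0.
Qed.

Lemma fnorm_ge0 A : 0 <= fnorm A.
Proof. exact: sqrtr_ge0. Qed.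

Lemma fnorm_sqr A : fnorm A ^+ 2 = fdot A A.
Proof. by rewrite sqr_sqrtr ?fdot_ge0. Qed.

Lemma fnorm_eq0 A : (fnorm A == 0) = (A == 0).
Proof. by rewrite -fdot_eq0 -fnorm_sqr sqrf_eq0. Qed.

Lemma fnorm0 : fnorm 0 = 0.
Proof. by apply/eqP; rewrite fnorm_eq0. Qed.

(** Cauchy-Schwarz: with [a] and [b] the two norms, the squared norm of [b *: A - a *: B] is
    [2 * (a * b) * (a * b - fdot A B)], and it is nonnegative. *)
Lemma fdot_le A B : fdot A B <= fnorm A * fnorm B.
Proof.
set a := fnorm A; set b := fnorm B.
have [|ab0] := eqVneq (a * b) 0.
  move=> ab; rewrite ab; move/eqP: ab; rewrite mulf_eq0 !fnorm_eq0.
  by case/orP => /eqP ->; rewrite /fdot ?trmx0 ?mul0mx ?mulmx0 linear0.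
have ab : 0 < a * b by rewrite lt_def ab0 mulr_ge0 ?fnorm_ge0.
rewrite -(ler_pM2l ab).
have := fdot_ge0 (b *: A - a *: B).
rewrite !fdotE (fdotC B A) -!fnorm_sqr -/a -/b => h.
nra.
Qed.

Lemma fnormD A B : fnorm (A + B) <= fnorm A + fnorm B.
Proof.
rewrite -(@ler_pXn2r _ 2) ?nnegrE ?addr_ge0 ?fnorm_ge0//.
rewrite sqrrD !fnorm_sqr !fdotE (fdotC B A).
have := fdot_le A B; lra.
Qed.

Lemma fnormZ (a : R) A : fnorm (a *: A) = `|a| * fnorm A.
Proof. by rewrite /fnorm !fdotE mulrA -expr2 sqrtrM ?sqr_ge0// sqrtr_sqr. Qed.

Lemma fnormN A : fnorm (- A) = fnorm A.
Proof. by rewrite -scaleN1r fnormZ normrN1 mul1r. Qed.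

Lemma fnormB A B : fnorm (A - B) <= fnorm A + fnorm B.
Proof. by rewrite -(fnormN B) fnormD. Qed.

Lemma fnorm_sub_trans B A C : fnorm (A - C) <= fnorm (A - B) + fnorm (B - C).
Proof. by have := fnormD (A - B) (B - C); rewrite subrKA. Qed.

Lemma fnorm_le A B : fdot A A <= fdot B B -> fnorm A <= fnorm B.
Proof. by move=> h; apply: ler_wsqrtr. Qed.

Lemma fnorm_scale_le (k : R) A B :
  0 <= k -> fdot A A <= k ^+ 2 * fdot B B -> fnorm A <= k * fnorm B.
Proof.
move=> k0 h; rewrite -(@ler_pXn2r _ 2) ?nnegrE ?mulr_ge0 ?fnorm_ge0//.
by rewrite exprMn !fnorm_sqr.
Qed.

Lemma entry_le_fnorm A i j : `|A i j| <= fnorm A.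
Proof.
rewrite -sqrtr_sqr; apply: ler_wsqrtr; rewrite fdot_sum (bigD1 i)//= (bigD1 j)//=.
rewrite -expr2 -addrA lerDl addr_ge0//.
  by apply: sumr_ge0 => ? _; rewrite -expr2 sqr_ge0.
by do 2![apply: sumr_ge0 => ? _]; rewrite -expr2 sqr_ge0.
Qed.

End Frobenius.

Lemma fdot_col (R : realType) m n (A B : 'M[R]_(m, n)) :
  fdot A B = \sum_j fdot (col j A) (col j B).
Proof.
rewrite fdot_sum exchange_big; apply: eq_bigr => j _; rewrite fdot_sum.
by apply: eq_bigr => i _; rewrite big_ord1 !mxE.
Qed.

Lemma fdot_row (R : realType) m n (A B : 'M[R]_(m, n)) :
  fdot A B = \sum_i fdot (row i A) (row i B).
Proof.
rewrite fdot_sum; apply: eq_bigr => j _; rewrite fdot_sum big_ord1.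
by apply: eq_bigr => i _; rewrite !mxE.
Qed.

Lemma dotv_fdot (R : realType) m (x y : 'cV[R]_m) : dotv x y = fdot x y.
Proof. by rewrite /dotv /fdot trace_mx11. Qed.

Lemma fnorm_le_sum (R : realType) m (x : 'cV[R]_m) :
  fnorm x <= \sum_i `|x i 0|.
Proof.
have s0 (F : 'I_m -> R) : 0 <= \sum_i `|F i| by apply: sumr_ge0.
rewrite -(@ler_pXn2r _ 2) ?nnegrE ?fnorm_ge0//.
rewrite fnorm_sqr fdot_sum expr2 mulr_suml; apply: ler_sum => i _.
rewrite big_ord1 -expr2 -[leLHS]ger0_norm ?sqr_ge0// expr2 normrM ler_wpM2l//.
by rewrite (bigD1 i)//= lerDl sumr_ge0.
Qed.

(** * Contraction of the mixing matrix *)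

Section Mixing.
Context {R : realType} {n : nat}.
Variables (e : rel 'I_n) (W : 'M[R]_n).
Hypotheses (W_sym : W = W^T) (W_ds : doubly_stochastic W).

(** The Dirichlet energy of the weighted graph: for symmetric doubly stochastic [W] it is twice the
    quadratic form of [1 - W] at [v]. *)
Definition disagreement (v : 'I_n -> R) : R :=
  \sum_i \sum_j W i j * (v i - v j) ^+ 2.

Let W_ge0 i j : 0 <= W i j.
Proof. by case: W_ds. Qed.

Let W_row i : \sum_j W i j = 1.
Proof. by case: W_ds. Qed.

Let W_col j : \sum_i W i j = 1.
Proof. by case: W_ds. Qed.

Lemma disagreement_ge0 v : 0 <= disagreement v.
Proof.
by apply: sumr_ge0 => i _; apply: sumr_ge0 => j _; rewrite mulr_ge0 ?sqr_ge0.
Qed.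

Lemma edge_le_disagreement v i j : W i j * (v i - v j) ^+ 2 <= disagreement v.
Proof.
rewrite /disagreement (bigD1 i)//= (bigD1 j)//= -addrA lerDl addr_ge0//.
  by apply: sumr_ge0 => k _; rewrite mulr_ge0 ?sqr_ge0.
by do 2![apply: sumr_ge0 => ? _]; rewrite mulr_ge0 ?sqr_ge0.
Qed.

(** Telescope [v] along the path with [(a + b)^2 <= 2 a^2 + 2 b^2] at each edge; a squared edge
    difference is at most the energy divided by the positive edge weight. The constant is uniform in
    [v]. *)
Lemma path_sqr_le_disagreement (W_edge : forall i j, e i j -> 0 < W i j) p i :
  path e i p -> exists2 C : R, 0 <= C &
    forall v, (v i - v (last i p)) ^+ 2 <= C * disagreement v.
Proof.
elim: p i => [|a p IH] i /=.
  by exists 0 => // v; rewrite subrr expr0n mul0r.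
case/andP=> /W_edge Wia /IH[C C0 hC]; exists (2 / W i a + 2 * C).
  by apply: addr_ge0; [apply: divr_ge0 => //; exact: ltW | apply: mulr_ge0].
move=> v; have := hC v; set z := v (last a p) => hz.
have := edge_le_disagreement v i a; rewrite mulrC -ler_pdivlMr// => h1.
rewrite mulrDl mulrAC.
have -> : 2 * disagreement v / W i a = 2 * (disagreement v / W i a).
  by rewrite mulrA.
have := sqr_ge0 (v i - v a - (v a - z)); nra.
Qed.

(** Plays the role of a spectral gap. Connectedness bounds every pairwise difference by the energy,
    and for mean-zero [v] the squared pairwise differences sum to [2 n] times the squared norm. *)
Lemma poincare (W_edge : forall i j, e i j -> 0 < W i j)
    (e_conn : forall i j, connect e i j) :
  exists2 K : R, 0 < K & forall v, \sum_i v i = 0 ->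
    \sum_i v i ^+ 2 <= K * disagreement v.
Proof.
have /choice[c cP] : forall ij : 'I_n * 'I_n, exists C : R, 0 <= C /\
    forall v, (v ij.1 - v ij.2) ^+ 2 <= C * disagreement v.
  case=> i j /=; have /connectP[p ep ->] := e_conn i j.
  by have [C C0 hC] := path_sqr_le_disagreement W_edge ep; exists C.
have S0 : 0 <= \sum_i \sum_j c (i, j).
  by apply: sumr_ge0 => i _; apply: sumr_ge0 => j _; case: (cP (i, j)).
exists (1 + \sum_i \sum_j c (i, j)) => [|v v0]; first by rewrite ltr_pwDl.
have hD := disagreement_ge0 v.
have h : \sum_i \sum_j (v i - v j) ^+ 2 <=
    (\sum_i \sum_j c (i, j)) * disagreement v.
  rewrite mulr_suml; apply: ler_sum => i _; rewrite mulr_suml.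
  by apply: ler_sum => j _; case: (cP (i, j)).
have E : \sum_i \sum_j (v i - v j) ^+ 2 = 2 * n%:R * \sum_i v i ^+ 2.
  under eq_bigr do under eq_bigr do rewrite sqrrB.
  under eq_bigr => i _.
    rewrite big_split/= sumrB sumr_const card_ord sumrMnl -mulr_sumr v0 mulr0 mul0rn subr0
    -mulr_natl; over.
  by rewrite big_split/= -mulr_sumr sumr_const card_ord -mulr_natl; ring.
have [n0|n0] := posnP n.
  rewrite big1 ?mulr_ge0 ?addr_ge0// => i _.
  by have := ltn_ord i; rewrite {2}n0.
have Q0 : 0 <= \sum_i v i ^+ 2 by apply: sumr_ge0 => ? _; exact: sqr_ge0.
have n1 : 1 <= n%:R :> R by rewrite ler1n.
rewrite E in h; nra.
Qed.


(* Jensen's inequality for the i-th row of W, keeping from the variance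
   only the deviation of node i from the weighted mean. *)
Lemma jensen_gap (v : 'I_n -> R) i :
  (\sum_j W i j * v j) ^+ 2 + 2^-1 * (W i i * \sum_j W i j * (v i - v j) ^+ 2)
  <= \sum_j W i j * v j ^+ 2.
Proof.
have E : \sum_k \sum_j W i k * (W i j * (v k - v j) ^+ 2) =
    2 * (\sum_j W i j * v j ^+ 2) - 2 * (\sum_j W i j * v j) ^+ 2.
  under eq_bigr => k _.
    under eq_bigr => j _.
      have -> : W i k * (W i j * (v k - v j) ^+ 2) =
        (W i k * v k ^+ 2) * W i j - (2 * (W i k * v k)) * (W i j * v j)
        + W i k * (W i j * v j ^+ 2) by ring.
      over.
    rewrite big_split/= sumrB -!mulr_sumr W_row mulr1; over.
  rewrite big_split/= sumrB -!mulr_suml W_row -mulr_sumr; ring.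
have h : W i i * \sum_j W i j * (v i - v j) ^+ 2 <=
    \sum_k \sum_j W i k * (W i j * (v k - v j) ^+ 2).
  rewrite [leRHS](bigD1 i)//= mulr_sumr lerDl.
  do 2![apply: sumr_ge0 => ? _]; apply: mulr_ge0 => //.
  by apply: mulr_ge0 => //; exact: sqr_ge0.
lra.
Qed.

(** Sum [jensen_gap] over the nodes: unit column sums turn the weighted second moments into the
    squared norm, and the diagonal bound makes the gap a multiple of the energy. *)
Lemma mixing_decrease (wmin : R) (W_diag : forall i, wmin <= W i i) v :
  \sum_i (\sum_j W i j * v j) ^+ 2 + wmin / 2 * disagreement v
  <= \sum_i v i ^+ 2.
Proof.
have -> : \sum_i v i ^+ 2 = \sum_i \sum_j W i j * v j ^+ 2.
  rewrite exchange_big/=; apply: eq_bigr => j _.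
  by rewrite -mulr_suml W_col mul1r.
rewrite mulr_sumr -big_split/=; apply: ler_sum => i _.
apply: le_trans (jensen_gap v i); rewrite lerD2l.
set D := \sum_j _; have D0 : 0 <= D.
  by apply: sumr_ge0 => j _; rewrite mulr_ge0 ?sqr_ge0.
have := W_diag i; nra.
Qed.

Lemma mixing_row (v : 'rV[R]_n) i : (v *m W) 0 i = \sum_j W i j * v 0 j.
Proof.
by rewrite mxE; apply: eq_bigr => j _; rewrite {1}W_sym mxE mulrC.
Qed.

Lemma mixing_le m (M : 'M[R]_(m, n)) : fnorm (M *m W) <= fnorm M.
Proof.
apply: fnorm_le; rewrite !(fdot_row (_ *m _)) (fdot_row M).
apply: ler_sum => k _; rewrite row_mul.
set v := row k M; rewrite !fdot_sum !big_ord1.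
have -> : \sum_j (v *m W) 0 j * (v *m W) 0 j =
    \sum_i (\sum_j W i j * v 0 j) ^+ 2.
  by apply: eq_bigr => i _; rewrite mixing_row expr2.
(* With diagonal bound 0 the energy term vanishes and plain nonexpansiveness remains. *)
have := @mixing_decrease 0 (fun i => W_ge0 i i) (v 0).
by rewrite !mul0r addr0.
Qed.

(** Each row of [M] has mean zero, so by the Poincare inequality the energy lost in one mixing is a
    fixed fraction of the squared norm. *)
Lemma mixing_contraction (wmin : R) (wmin_gt0 : 0 < wmin)
    (W_diag : forall i, wmin <= W i i)
    (W_edge : forall i j, e i j -> 0 < W i j)
    (e_conn : forall i j, connect e i j) :
  exists2 rho : R, 0 <= rho < 1 & forall m (M : 'M[R]_(m, n)),
    (forall k, \sum_j M k j = 0) -> fnorm (M *m W) <= rho * fnorm M.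
Proof.
have [K K0 hK] := poincare W_edge e_conn.
(* The extra [wmin] in the denominator forces [t < 1], so that the square root below is meaningful,
   while [t * (2 * K) <= wmin] still holds. *)
pose t := wmin / (2 * K + wmin).
have den0 : 0 < 2 * K + wmin by lra.
have t0 : 0 < t by rewrite divr_gt0.
have t1 : t < 1 by rewrite ltr_pdivrMr// mul1r; lra.
have tK : t * (2 * K) <= wmin.
  rewrite mulrAC ler_pdivrMr//; nra.
exists (Num.sqrt (1 - t)).
  by rewrite sqrtr_ge0/= -[ltRHS]sqrtr1 ltr_sqrt//; lra.
move=> m M M0; apply: fnorm_scale_le; rewrite ?sqrtr_ge0// sqr_sqrtr ?subr_ge0 ?(ltW t1)//.
rewrite !(fdot_row (_ *m _)) (fdot_row M) mulr_sumr.
apply: ler_sum => k _; rewrite row_mul.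
set v := row k M; rewrite !fdot_sum !big_ord1.
have -> : \sum_j (v *m W) 0 j * (v *m W) 0 j =
    \sum_i (\sum_j W i j * v 0 j) ^+ 2.
  by apply: eq_bigr => i _; rewrite mixing_row expr2.
have -> : \sum_j v 0 j * v 0 j = \sum_i v 0 i ^+ 2 by [].
have := mixing_decrease W_diag (v 0).
have /hK : \sum_i v 0 i = 0 by rewrite -[RHS](M0 k); apply: eq_bigr => j _; rewrite mxE.
have := disagreement_ge0 (v 0); nra.
Qed.

End Mixing.

(** * Gradients of strongly convex functions *)

(** With [c = C / (1 - q)], the sequence [u k - c * q ^+ k] increases, [u k + c * q ^+ k] decreases,
    and the first stays below the second. The supremum of the first is the limit, with the explicit
    error bound. *)
Lemma geometric_increments_limit (R : realType) (u : nat -> R) (C q : R) :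
  0 <= q < 1 -> (forall k, `|u k.+1 - u k| <= C * q ^+ k) ->
  exists l, forall k, `|u k - l| <= C / (1 - q) * q ^+ k.
Proof.
move=> /andP[q0 q1] hu; pose c := C / (1 - q).
have cC : c * (1 - q) = C by rewrite divfK// subr_eq0 eq_sym lt_eqF.
have C0 : 0 <= C by have := hu 0%N; rewrite expr0 mulr1; apply: le_trans.
have c0 : 0 <= c by rewrite divr_ge0// subr_ge0 ltW.
pose v k := u k - c * q ^+ k; pose w k := u k + c * q ^+ k.
have vS k : v k <= v k.+1.
  by have := hu k; rewrite ler_norml /v exprS -cC => /andP[h _]; lra.
have wS k : w k.+1 <= w k.
  by have := hu k; rewrite ler_norml /w exprS -cC => /andP[_ h]; lra.
have vm : {homo v : i j / (i <= j)%N >-> i <= j}.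
  by apply: homo_leq => // ? ? ?; exact: le_trans.
have wm i j : (i <= j)%N -> w j <= w i.
  move=> /subnK <-; elim: (j - i)%N => // k; apply: le_trans; exact: wS.
have vw i : v i <= w i by have := mulr_ge0 c0 (exprn_ge0 i q0); rewrite /v /w; lra.
have vwij i j : v i <= w j.
  have [ij|/ltnW ji] := leqP i j; first exact: le_trans (vm _ _ ij) (vw j).
  exact: le_trans (vw i) (wm _ _ ji).
have hs : has_sup (range v).
  by split; [exists (v 0%N), 0%N | exists (w 0%N) => _ [k _ <-]].
exists (sup (range v)) => k.
have h1 : v k <= sup (range v) by apply: (ub_le_sup hs.2); exists k.
have h2 : sup (range v) <= w k by apply: (ge_sup hs.1) => _ [i _ <-].
by rewrite ler_norml; move: h1 h2; rewrite /v /w -/c => h1 h2; apply/andP; split; lra.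
Qed.

Lemma le0_geometric (R : realType) (a C q : R) :
  0 <= q < 1 -> (forall k, a <= C * q ^+ k) -> a <= 0.
Proof.
move=> /andP[q0 q1] h.
have cv : ((fun k => C * q ^+ k) @ \oo --> (0 : R))%classic.
  by apply: cvg_geometric; rewrite ger0_norm.
rewrite -(cvg_lim _ cv)//; apply: limr_ge; first by apply/cvg_ex; exists 0.
by near=> k; exact: h.
Unshelve. all: by end_near. Qed.

Section Line.
Context {R : realType} {m : nat}.
Implicit Types (g : 'cV[R]_m -> R) (x s : 'cV[R]_m).

Lemma is_derive_line g x s t : differentiable g (x + t *: s) ->
  is_derive t 1 (fun r : R => g (x + r *: s)) ('D_s g (x + t *: s)).
Proof.
move=> dg; have E : (fun h : R => h^-1 *: (((fun r : R => g (x + r *: s)) \o shift t) (h *: 1) -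
    g (x + t *: s))) =
  (fun h : R => h^-1 *: ((g \o shift (x + t *: s)) (h *: s) - g (x + t *: s))).
  apply/funext => h /=; congr (_ *: (g _ - _)).
  by rewrite scaler1 scalerDl addrCA.
split; last by rewrite /derive E.
by rewrite /derivable E; exact: diff_derivable.
Qed.

Lemma derive_grad g x s : differentiable g x -> 'D_s g x = fdot (grad g x) s.
Proof.
move=> dg; rewrite (deriveE _ dg).
have -> : s = \sum_i s i 0 *: basisv i.
  rewrite [LHS]matrix_sum_delta; apply: eq_bigr => i _.
  by rewrite big_ord1.
rewrite linear_sum fdot_sum; apply: eq_bigr => i _.
rewrite big_ord1 linearZ/= -deriveE// !mxE summxE (bigD1 i)//= big1 => [|j ji].
  by rewrite !mxE !eqxx addr0 mulr1 [RHS]mulrC.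
by rewrite !mxE eq_sym (negPf ji) mulr0.
Qed.

Section Strong.
Variables (g : 'cV[R]_m -> R) (mu L : R).
Hypotheses (g_C2 : C2 g) (g_hess : forall x,
  lownerle mu%:M (hess g x) /\ lownerle (hess g x) L%:M).

Let g_diff x : differentiable g x.
Proof. by case: g_C2. Qed.

Let gradi_diff i x : differentiable (fun z => grad g z i 0) x.
Proof.
case: g_C2 => _ h _.
exact: (differentiable_comp (h x) (differentiable_coord _ _ _)).
Qed.

Lemma is_derive_grad_line x s (t : R) :
  is_derive t (1 : R) (fun r : R => fdot (grad g (x + r *: s)) s)
    (fdot s (hess g (x + t *: s) *m s)).
Proof.
have -> : (fun r : R => fdot (grad g (x + r *: s)) s) =
    \sum_i (s i 0 \*: (fun r : R => grad g (x + r *: s) i 0)).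
  apply/funext => r; rewrite fct_sumE fdot_sum; apply: eq_bigr => i _.
  by rewrite big_ord1 mulrC.
have -> : fdot s (hess g (x + t *: s) *m s) =
    \sum_i (s i 0 *: 'D_s (fun z => grad g z i 0) (x + t *: s)).
  rewrite fdot_sum; apply: eq_bigr => i _; rewrite big_ord1; congr (_ * _).
  rewrite derive_grad // fdot_sum mxE; apply: eq_bigr => j _.
  by rewrite big_ord1 !mxE.
apply: is_derive_sum => i; apply: is_deriveZ; exact: is_derive_line.
Qed.

(** The mean value theorem is applied to the scalar function [r |-> fdot (grad g (x + r *: s)) s],
    so the Hessian enters only through its quadratic form in the direction [s]. *)
Lemma grad_secant x s : exists2 c : R, 0 < c &
  fdot (grad g (x + s) - grad g x) s = fdot s (hess g (x + c *: s) *m s).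
Proof.
have [|c] := @MVT R (fun r : R => fdot (grad g (x + r *: s)) s) _ 0 1 ltr01
  (fun t _ => is_derive_grad_line x s t).
  apply: derivable_within_continuous => t _.
  by case: (is_derive_grad_line x s t).
rewrite in_itv/= => /andP[c0 _]; rewrite scale1r scale0r !addr0 subr0 mulr1 => h.
by exists c; rewrite // fdotBl.
Qed.

Lemma grad_secant_ge x s : mu * fdot s s <= fdot (grad g (x + s) - grad g x) s.
Proof.
have [c _ ->] := grad_secant x s; have [/(_ s) + _] := g_hess (x + c *: s).
by rewrite dotv_fdot mulmxBl fdotBr mul_scalar_mx fdotZr subr_ge0.
Qed.

Lemma grad_secant_le x s : fdot (grad g (x + s) - grad g x) s <= L * fdot s s.
Proof.
have [c _ ->] := grad_secant x s; have [_ /(_ s)] := g_hess (x + c *: s).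
by rewrite dotv_fdot mulmxBl fdotBr mul_scalar_mx fdotZr subr_ge0.
Qed.

(** The mean value theorem for [g] on the segment. Multiplying by [c] makes the increment on the
    right equal to [c *: s], the shape to which the secant bounds apply. *)
Lemma taylor_secant x s : exists2 c : R, 0 < c < 1 &
  c * (g (x + s) - g x - fdot (grad g x) s) =
  fdot (grad g (x + c *: s) - grad g x) (c *: s).
Proof.
have [|c] := @MVT R (fun r : R => g (x + r *: s)) _ 0 1 ltr01
  (fun t _ => @is_derive_line g x s t (g_diff _)).
  apply: derivable_within_continuous => t _.
  by case: (@is_derive_line g x s t (g_diff _)).
rewrite in_itv/= => c01; rewrite scale1r scale0r !addr0 subr0 mulr1 => h.
by exists c; rewrite // fdotZr h derive_grad// fdotBl.
Qed.

Lemma strict_convexity (mu_gt0 : 0 < mu) x s : s != 0 ->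
  g x + fdot (grad g x) s < g (x + s).
Proof.
move=> s0; have [c /andP[c0 _] h] := taylor_secant x s.
have := grad_secant_ge x (c *: s); rewrite -h => {h}.
have : 0 < mu * fdot (c *: s) (c *: s).
  by rewrite mulr_gt0// lt_def fdot_eq0 fdot_ge0 scaler_eq0 (gt_eqF c0) s0.
move=> /lt_le_trans /[apply]; rewrite pmulr_rgt0//; lra.
Qed.

Lemma convexity (mu_gt0 : 0 < mu) x s : g x + fdot (grad g x) s <= g (x + s).
Proof.
have [->|s0] := eqVneq s 0; last exact/ltW/strict_convexity.
by rewrite fdotC fdot0l !addr0.
Qed.

(** The constant is [L] instead of the sharp [L / 2] because the intermediate point is only known to
    satisfy [c < 1]; this is the source of the Lipschitz constant [2 * L]. *)
Lemma descent (L_ge0 : 0 <= L) x s :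
  g (x + s) <= g x + fdot (grad g x) s + L * fdot s s.
Proof.
have [c /andP[c0 c1] h] := taylor_secant x s.
have := grad_secant_le x (c *: s); rewrite -h => {h}.
rewrite fdotZl fdotZr => h.
have : g (x + s) - g x - fdot (grad g x) s <= c * (L * fdot s s).
  by rewrite -(ler_pM2l c0); apply: le_trans h _; lra.
have := mulr_ge0 L_ge0 (fdot_ge0 s); nra.
Qed.

(* The Hessian is not assumed symmetric, so its operator norm is not directly
   bounded by L; the Baillon-Haddad argument needs only the quadratic form. *)
Lemma grad_lipschitz (mu_gt0 : 0 < mu) (L_gt0 : 0 < L) x y :
  fnorm (grad g y - grad g x) <= 2 * L * fnorm (y - x).
Proof.
set w := grad g y - grad g x; set s := y - x.
have xs : x + s = y by rewrite addrC subrK.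
pose t := (2 * L)^-1.
have tL : t * L = 2^-1 by rewrite /t; field; rewrite gt_eqF.
(* Compare [g] at [y - t *: w] from both sides: from below by the tangent at [x], from above by
   descent from [y]. Bounding [g y] by descent from [x] leaves [t - L t^2] times [fdot w w], and
   [t = 1 / (2 L)] maximizes this factor. *)
have h1 := convexity mu_gt0 x (s - t *: w).
have h2 := descent (ltW L_gt0) y (- (t *: w)).
rewrite addrA xs in h1.
have := descent (ltW L_gt0) x s; rewrite xs => h3.
have h4 : fdot w w = fdot (grad g y) w - fdot (grad g x) w.
  by rewrite {1}/w fdotBl.
move: w s xs h1 h2 h3 h4 => w s _ h1 h2 h3 h4.
apply: fnorm_scale_le; first by rewrite mulr_ge0// ltW.
move: h1 h2; rewrite !fdotE => h1 h2.
have h5 : t * fdot w w - (t * L) * (t * fdot w w) <= L * fdot s s by rewrite {1}h4; lra.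
rewrite tL in h5.
have h6 : t * fdot w w <= 2 * L * fdot s s by lra.
rewrite expr2 -mulrA -ler_pdivrMl ?mulr_gt0//.
Qed.

End Strong.
End Line.

(* For t = a / M^2 the map z |-> z - t G z is a contraction. *)
Lemma strongly_monotone_zero (R : realType) m (G : 'cV[R]_m -> 'cV[R]_m)
    (a M : R) : 0 < a -> a <= M ->
  (forall z w, a * fdot (z - w) (z - w) <= fdot (G z - G w) (z - w)) ->
  (forall z w, fnorm (G z - G w) <= M * fnorm (z - w)) ->
  exists z, G z = 0.
Proof.
move=> a0 aM mono lip.
have M0 : 0 < M by exact: lt_le_trans aM.
pose t := a / M ^+ 2.
have t0 : 0 < t by rewrite divr_gt0// exprn_gt0.
have tM : t * M ^+ 2 = a by rewrite divfK// gt_eqF// exprn_gt0.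
have ta : 0 < t * a <= 1.
  rewrite mulr_gt0//= /t mulrAC ler_pdivrMr ?exprn_gt0// mul1r -expr2.
  by rewrite ler_pXn2r ?nnegrE// ltW.
pose T z := z - t *: G z; pose q := Num.sqrt (1 - t * a).
have q01 : 0 <= q < 1.
  by rewrite sqrtr_ge0 -[ltRHS]sqrtr1 ltr_sqrt//; lra.
have T_contr z w : fnorm (T z - T w) <= q * fnorm (z - w).
  apply: fnorm_scale_le; first by rewrite sqrtr_ge0.
  rewrite sqr_sqrtr; last by lra.
  have -> : T z - T w = (z - w) - t *: (G z - G w).
    by apply/matrixP => i j; rewrite !mxE; ring.
  have h1 := mono z w; have := lip z w.
  move: (z - w) (G z - G w) h1 => s y h1.
  rewrite -(@ler_pXn2r _ 2) ?nnegrE ?mulr_ge0 ?fnorm_ge0 ?(ltW M0)//.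
  rewrite exprMn !fnorm_sqr => h2.
  rewrite !fdotE (fdotC s y).
  have h3 : t * t * fdot y y <= t * (a * fdot s s).
    have tt : 0 <= t * t by rewrite mulr_ge0 ?ltW.
    by have := ler_wpM2l tt h2; rewrite -tM; lra.
  have h4 : t * (a * fdot s s) <= t * fdot y s by rewrite ler_pM2l.
  lra.
(* Banach iteration: its increments decay geometrically, so every coordinate converges with an
   explicit rate. *)
pose z k := iter k T 0.
pose c := fnorm (z 1%N - z 0%N).
have zS k : fnorm (z k.+1 - z k) <= c * q ^+ k.
  elim: k => [|k IH]; first by rewrite expr0 mulr1.
  apply: le_trans (T_contr _ _) _; rewrite exprS mulrCA ler_wpM2l//.
  by case/andP: q01.
have /choice[l lP] : forall i, exists l,
    forall k, `|z k i 0 - l| <= c / (1 - q) * q ^+ k.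
  move=> i; apply: geometric_increments_limit => // k.
  by apply: le_trans (zS k); have := entry_le_fnorm (z k.+1 - z k) i 0; rewrite !mxE.
pose zs := \col_i l i.
have zzs k : fnorm (z k - zs) <= m%:R * (c / (1 - q)) * q ^+ k.
  apply: le_trans (fnorm_le_sum _) _.
  rewrite -mulrA mulr_natl -[X in _ *+ X]card_ord -sumr_const.
  by apply: ler_sum => i _; rewrite !mxE.
exists zs; apply/eqP; rewrite -fnorm_eq0 eq_le fnorm_ge0 andbT.
(* [G (z k)] is a rescaled increment and [G (z k) - G zs] is controlled by the Lipschitz bound; both
   decay like [q ^+ k], hence [G zs] vanishes. *)
apply: (@le0_geometric _ _ (c / t + M * (m%:R * (c / (1 - q)))) q) => // k.
have Gz : G (z k) = t^-1 *: (z k - z k.+1).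
  by rewrite /= /T opprB addrC subrK scalerA mulVf ?scale1r// gt_eqF.
have -> : G zs = G (z k) - (G (z k) - G zs) by rewrite opprB addrC subrK.
apply: le_trans (fnormB _ _) _; rewrite mulrDl; apply: lerD.
  rewrite Gz fnormZ ger0_norm ?invr_ge0 ?(ltW t0)// mulrC mulrAC ler_wpM2r ?invr_ge0 ?(ltW t0)//.
  by rewrite -fnormN opprB.
by apply: le_trans (lip _ _) _; rewrite -mulrA ler_pM2l.
Qed.

(** * Perturbed gradient tracking *)

Section Projection.
Context {R : realType} {m n : nat}.
Variable J : 'M[R]_n.
Hypotheses (J_sym : J^T = J) (J_idem : J *m J = J).
Implicit Types M : 'M[R]_(m, n).

Lemma pythagoras M :
  fdot (M *m J) (M *m J) + fdot (M - M *m J) (M - M *m J) = fdot M M.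
Proof.
have E : fdot (M *m J) (M *m J) = fdot (M *m J) M.
  by rewrite fdotC fdot_mulmxl J_sym -mulmxA J_idem fdotC.
rewrite !fdotE (fdotC M (M *m J)) E; ring.
Qed.

Lemma fnorm_proj_le M : fnorm (M *m J) <= fnorm M.
Proof. by apply: fnorm_le; rewrite -(pythagoras M) lerDl fdot_ge0. Qed.

Lemma fnorm_coproj_le M : fnorm (M - M *m J) <= fnorm M.
Proof. by apply: fnorm_le; rewrite -(pythagoras M) lerDr fdot_ge0. Qed.

End Projection.

Section Tracking.
Context {R : realType} {m n : nat}.
Variables (J W : 'M[R]_n) (rho mu L : R).
Hypotheses (J_sym : J^T = J) (J_idem : J *m J = J).
Hypotheses (WJ : W *m J = J) (JW : J *m W = J).
Hypothesis W_le : forall M : 'M[R]_(m, n), fnorm (M *m W) <= fnorm M.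
Hypothesis W_contr : forall M : 'M[R]_(m, n),
  M *m J = 0 -> fnorm (M *m W) <= rho * fnorm M.
Hypotheses (mu_gt0 : 0 < mu) (le_mu_L : mu <= L).
Variable G : 'M[R]_(m, n) -> 'M[R]_(m, n).
Hypothesis G_mono :
  forall A B, mu * fdot (A - B) (A - B) <= fdot (G A - G B) (A - B).
Hypothesis G_lip : forall A B, fnorm (G A - G B) <= L * fnorm (A - B).
Variable S : 'M[R]_(m, n).
Hypotheses (SJ : S *m J = S) (GSJ : G S *m J = 0).

Let L_gt0 : 0 < L. Proof. exact: lt_le_trans le_mu_L. Qed.

Lemma consensus_contraction (M : 'M[R]_(m, n)) :
  fnorm (M *m W - M *m J) <= rho * fnorm (M - M *m J).
Proof.
have -> : M *m W - M *m J = (M - M *m J) *m W.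
  by rewrite mulmxBl -(mulmxA M J W) JW.
by apply: W_contr; rewrite mulmxBl -mulmxA J_idem subrr.
Qed.

(** Gradient descent among consensus matrices, where [J] can be moved across the inner product and
    monotonicity survives averaging. The condition on [alpha] absorbs the quadratic term, leaving
    the squared factor [1 - alpha * mu], at most [(1 - alpha * mu / 2) ^+ 2]. *)
Lemma mean_gradient_step (alpha : R) (Z : 'M[R]_(m, n)) :
  0 < alpha -> alpha * L ^+ 2 <= mu -> Z *m J = Z ->
  fnorm (Z - S - alpha *: (G Z *m J)) <= (1 - alpha * mu / 2) * fnorm (Z - S).
Proof.
move=> a0 aL ZJ.
have amu : alpha * mu <= 1.
  rewrite -(ler_pM2r mu_gt0) mul1r -mulrA; apply: le_trans aL.
  rewrite ler_pM2l// -expr2; rewrite ler_pXn2r ?nnegrE// ltW//.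
have eqGJ : G Z *m J = (G Z - G S) *m J by rewrite mulmxBl GSJ subr0.
have ZSJ : (Z - S) *m J = Z - S by rewrite mulmxBl ZJ SJ.
have h1 : mu * fdot (Z - S) (Z - S) <= fdot (G Z *m J) (Z - S).
  by rewrite eqGJ fdot_mulmxl J_sym ZSJ.
have h2 : fdot (G Z *m J) (G Z *m J) <= L ^+ 2 * fdot (Z - S) (Z - S).
  rewrite -!fnorm_sqr -exprMn ler_pXn2r ?nnegrE ?mulr_ge0 ?fnorm_ge0 ?(ltW L_gt0)//.
  by rewrite eqGJ; apply: le_trans (fnorm_proj_le J_sym J_idem _) _.
apply: fnorm_scale_le; first by lra.
move: (Z - S) (G Z *m J) h1 h2 => s y h1 h2.
rewrite !fdotE (fdotC s y).
have h3 : alpha * (mu * fdot s s) <= alpha * fdot y s by rewrite ler_pM2l.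
have h4 : alpha * (alpha * fdot y y) <= alpha * (mu * fdot s s).
  rewrite ler_pM2l//; apply: (@le_trans _ _ (alpha * (L ^+ 2 * fdot s s))).
    by rewrite ler_pM2l.
  by rewrite mulrA ler_wpM2r// fdot_ge0.
have h5 : 0 <= (alpha * mu) ^+ 2 * fdot s s by rewrite mulr_ge0 ?sqr_ge0 ?fdot_ge0.
lra.
Qed.

(** Split [Y] into mean and deviation; the mean is that of [G X], which vanishes when [X] is [S], so
    the Lipschitz bound applies. *)
Lemma tracking_norm_le (X Y : 'M[R]_(m, n)) : Y *m J = G X *m J ->
  fnorm Y <= fnorm (Y - Y *m J)
    + L * (fnorm (X *m J - S) + fnorm (X - X *m J)).
Proof.
move=> YJ; rewrite -{1}[Y](subrK (Y *m J)).
apply: le_trans (fnormD _ _) _; rewrite lerD2l YJ.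
have -> : G X *m J = (G X - G S) *m J by rewrite mulmxBl GSJ subr0.
apply: le_trans (fnorm_proj_le J_sym J_idem _) _.
apply: le_trans (G_lip _ _) _; rewrite ler_pM2l// [leRHS]addrC.
exact: fnorm_sub_trans.
Qed.

Section Step.
Variables (alpha eps : R) (X Y Z : 'M[R]_(m, n)).
Hypotheses (a0 : 0 < alpha) (aL : alpha * L ^+ 2 <= mu) (e1 : eps <= 1).
Hypothesis YJ : Y *m J = G X *m J.
Hypothesis Z_le : fnorm Z <= eps * fnorm Y.

(** One perturbed step: [Z] collects the deviation of the individual step-sizes from the constant
    [alpha]. *)
Let X' := X *m W - alpha *: (Y - Z).
Let Y' := Y *m W + (G X' - G X).

Lemma tracking_mean : Y' *m J = G X' *m J.
Proof. by rewrite mulmxDl -mulmxA WJ mulmxBl YJ addrC subrK. Qed.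

Lemma tracking_optimality :
  fnorm (X' *m J - S) <= (1 - alpha * mu / 2) * fnorm (X *m J - S)
    + alpha * L * fnorm (X - X *m J) + alpha * eps * fnorm Y.
Proof.
(* Three parts: an exact gradient step at the mean, the error of evaluating gradients at the nodes
   instead of at the mean, and the step-size perturbation. *)
have -> : X' *m J - S = (X *m J - S - alpha *: (G (X *m J) *m J))
    + alpha *: ((G (X *m J) - G X) *m J) + alpha *: (Z *m J).
  rewrite /X' mulmxBl -(mulmxA X) WJ -scalemxAl mulmxBl YJ mulmxBl.
  by apply/matrixP => i j; rewrite !mxE; ring.
apply: le_trans (fnormD _ _) _; apply: lerD.
  apply: le_trans (fnormD _ _) _; apply: lerD.
    by apply: mean_gradient_step => //; rewrite -mulmxA J_idem.
  rewrite fnormZ gtr0_norm// -mulrA ler_pM2l//.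
  apply: le_trans (fnorm_proj_le J_sym J_idem _) _.
  by apply: le_trans (G_lip _ _) _; rewrite ler_pM2l// -fnormN opprB.
rewrite fnormZ gtr0_norm// -mulrA ler_pM2l//.
exact: le_trans (fnorm_proj_le J_sym J_idem _) Z_le.
Qed.

Lemma tracking_consensus :
  fnorm (X' - X' *m J) <= rho * fnorm (X - X *m J)
    + alpha * fnorm (Y - Y *m J) + alpha * eps * fnorm Y.
Proof.
have -> : X' - X' *m J = (X *m W - X *m J)
    - alpha *: (Y - Y *m J) + alpha *: (Z - Z *m J).
  rewrite /X' mulmxBl -(mulmxA X) WJ -scalemxAl mulmxBl.
  by apply/matrixP => i j; rewrite !mxE; ring.
apply: le_trans (fnormD _ _) _; apply: lerD.
  apply: le_trans (fnormB _ _) _; apply: lerD; first exact: consensus_contraction.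
  by rewrite fnormZ gtr0_norm.
rewrite fnormZ gtr0_norm// -mulrA ler_pM2l//.
exact: le_trans (fnorm_coproj_le J_sym J_idem _) Z_le.
Qed.

Lemma tracking_gradient :
  fnorm (Y' - Y' *m J) <= rho * fnorm (Y - Y *m J)
    + L * (2 * fnorm (X - X *m J) + 2 * alpha * fnorm Y).
Proof.
have -> : Y' - Y' *m J = (Y *m W - Y *m J)
    + ((G X' - G X) - (G X' - G X) *m J).
  rewrite /Y' mulmxDl -(mulmxA Y) WJ.
  by apply/matrixP => i j; rewrite !mxE; ring.
apply: le_trans (fnormD _ _) _; apply: lerD; first exact: consensus_contraction.
apply: le_trans (fnorm_coproj_le J_sym J_idem _) _.
apply: le_trans (G_lip _ _) _; rewrite ler_pM2l//.
(* Since [J *m W = J], mixing moves [X] only through its deviation from the mean, so the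
   displacement is small near consensus. *)
have -> : X' - X = ((X - X *m J) *m W - (X - X *m J)) - alpha *: (Y - Z).
  rewrite /X' mulmxBl -(mulmxA X J W) JW.
  by apply/matrixP => i j; rewrite !mxE; ring.
apply: le_trans (fnormB _ _) _; apply: lerD.
  by apply: le_trans (fnormB _ _) _; have := W_le (X - X *m J); lra.
rewrite fnormZ gtr0_norm// [2 * _]mulrC -mulrA ler_pM2l//.
have := ler_wpM2r (fnorm_ge0 Y) e1; rewrite mul1r => h.
have := fnormB Y Z; have := Z_le; lra.
Qed.

End Step.
End Tracking.

Lemma small_gain (R : realType) (rho mu L : R) :
  0 <= rho < 1 -> 0 < mu -> mu <= L ->
  exists alpha eps q r delta : R,
    [/\ [/\ 0 < alpha, alpha * L ^+ 2 <= mu, 0 < eps, eps <= 1 & 0 < q],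
        0 < r, 0 < delta < 1 &
    forall A b c y A' b' c' : R, 0 <= A -> 0 <= b -> 0 <= c ->
      y <= c + L * (A + b) ->
      A' <= (1 - alpha * mu / 2) * A + alpha * L * b + alpha * eps * y ->
      b' <= rho * b + alpha * c + alpha * eps * y ->
      c' <= rho * c + L * (2 * b + 2 * alpha * y) ->
      A' + q * b' + r * c' <= delta * (A + q * b + r * c)].
Proof.
move=> /andP[rho0 rho1] mu0 muL.
have L0 : 0 < L by exact: lt_le_trans muL.
have k0 : 0 < 1 - rho by rewrite subr_gt0.
(* The weight [r] is small enough that the feedback of [y] through [c'] costs the optimality error
   only [al * mu / 8]. *)
pose r := mu / (16 * L ^+ 2).
have r0 : 0 < r by rewrite divr_gt0// mulr_gt0// exprn_gt0.
have rE : r * L ^+ 2 = mu / 16 by rewrite /r; field; rewrite gt_eqF.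
(* Half of the consensus gain, [q * (1 - rho) / 2 = 4 * r * L], has to pay for the term [2 * r * L]
   and for two terms that a small [al] controls. *)
pose q := 8 * r * L / (1 - rho).
have rL0 : 0 < r * L by exact: mulr_gt0.
have q0 : 0 < q by rewrite divr_gt0// -mulrA; lra.
(* The choice of [eps] that follows limits the perturbation terms to another [al * mu / 8], so half
   of the optimality gain [al * mu / 2] survives. *)
have qE : q * (1 - rho) = 8 * r * L by rewrite divfK// gt_eqF.
pose eps := mu / (8 * (1 + q) * L).
have e0 : 0 < eps by rewrite divr_gt0//; apply: mulr_gt0 => //; lra.
have eE : eps * (1 + q) * L = mu / 8.
  by rewrite /eps; field; rewrite (gt_eqF L0)/= gt_eqF//; lra.
have e1 : eps * (1 + q) <= 1.
  by rewrite -(ler_pM2r L0) eE mul1r; lra.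
have e1' : eps <= 1 by nra.
(* Upper bounds for the step: [a1] serves the mean gradient step, [a2] keeps [al * L] below an
   eighth of the consensus gain, [a3] keeps the coefficients fed into [c] below half of its gain. *)
pose a1 := mu / L ^+ 2.
pose a2 := q * (1 - rho) / (8 * L).
pose a3 := r * (1 - rho) / (2 * (1 + q + 2 * r * L)).
have den : 0 < 1 + q + 2 * r * L by lra.
have a10 : 0 < a1 by rewrite divr_gt0// exprn_gt0.
have a20 : 0 < a2 by apply: divr_gt0; [exact: mulr_gt0 | lra].
have a30 : 0 < a3 by apply: divr_gt0; [exact: mulr_gt0 | lra].
pose al := Num.min a1 (Num.min a2 a3).
have al0 : 0 < al by rewrite !lt_min a10 a20 a30.
have := lexx al; rewrite {2}/al !le_min => /and3P[h1 h2 h3].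
move: h1 h2 h3; rewrite !ler_pdivlMr ?exprn_gt0//; [move=> h1 h2 h3|lra|lra].
have h4 : al * mu <= 1.
  rewrite -(ler_pM2r mu0) mul1r -mulrA; apply: le_trans h1.
  by rewrite ler_pM2l// -expr2 ler_pXn2r ?nnegrE// ltW.
pose eta := Num.min (al * mu / 4) ((1 - rho) / 2).
have eta0 : 0 < eta by rewrite lt_min !divr_gt0// mulr_gt0.
have := lexx eta; rewrite {2}/eta le_min => /andP[g1 g2].
clearbody eta al eps q r; clear a1 a2 a3 a10 a20 a30.
exists al, eps, q, r, (1 - eta); split=> //; first by apply/andP; split; lra.
move=> A b c y A' b' c' A0 b0 c0 hy hA hb hc.
(* The total coefficient of [y] in the weighted sum. *)
pose t := al * eps * (1 + q) + 2 * r * L * al.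
have t0 : 0 <= t by rewrite /t addr_ge0// !mulr_ge0// ?addr_ge0// ltW.
have H : A' + q * b' + r * c' <= (1 - al * mu / 2) * A + al * L * b
    + q * (rho * b + al * c) + r * (rho * c + 2 * L * b)
    + t * (c + L * (A + b)).
  have := ler_wpM2l (ltW q0) hb; have := ler_wpM2l (ltW r0) hc.
  have := ler_wpM2l t0 hy; rewrite /t; lra.
apply: le_trans H _.
have tL : t * L = al * mu / 4.
  have -> : t * L = al * (eps * (1 + q) * L) + 2 * al * (r * L ^+ 2).
    by rewrite /t; ring.
  by rewrite eE rE; field.
have t1 : t <= al * (1 + 2 * r * L).
  by have := ler_wpM2l (ltW al0) e1; rewrite /t; lra.
have cA : (1 - al * mu / 2 + t * L) * A <= (1 - eta) * A.
  by rewrite ler_wpM2r// tL; lra.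
have cb : (al * L + q * rho + 2 * r * L + t * L) * b <= (1 - eta) * q * b.
  rewrite ler_wpM2r// tL.
  have : al * mu <= al * L by rewrite ler_pM2l.
  have := ler_wpM2l (ltW q0) g2; lra.
have cc : (q * al + r * rho + t) * c <= (1 - eta) * r * c.
  rewrite ler_wpM2r//.
  have := ler_wpM2l (ltW r0) g2; lra.
lra.
Qed.

Lemma tracking_linear_rate (R : realType) (m n : nat) (J W : 'M[R]_n)
    (rho mu L : R) (G : 'M[R]_(m, n) -> 'M[R]_(m, n)) (S : 'M[R]_(m, n)) :
  0 <= rho < 1 -> 0 < mu -> mu <= L ->
  J^T = J -> J *m J = J -> W *m J = J -> J *m W = J ->
  (forall M : 'M[R]_(m, n), fnorm (M *m W) <= fnorm M) ->
  (forall M : 'M[R]_(m, n), M *m J = 0 -> fnorm (M *m W) <= rho * fnorm M) ->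
  (forall A B, mu * fdot (A - B) (A - B) <= fdot (G A - G B) (A - B)) ->
  (forall A B, fnorm (G A - G B) <= L * fnorm (A - B)) ->
  S *m J = S -> G S *m J = 0 ->
  exists alpha eps : R, [/\ 0 < alpha, 0 < eps &
    forall X Y Z : nat -> 'M[R]_(m, n),
      Y 0%N = G (X 0%N) ->
      (forall k, X k.+1 = X k *m W - alpha *: (Y k - Z k)) ->
      (forall k, Y k.+1 = Y k *m W + (G (X k.+1) - G (X k))) ->
      (forall k, fnorm (Z k) <= eps * fnorm (Y k)) ->
      exists C delta : R, [/\ 0 < C, 0 < delta < 1 &
        forall k, fnorm (X k - S) <= C * delta ^+ k]].
Proof.
move=> rho01 mu0 muL J_sym J_idem WJ JW W_le W_contr G_mono G_lip SJ GSJ.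
have [alpha [eps [q [r [delta []]]]]] := small_gain rho01 mu0 muL.
case=> a0 aL e0 e1 q0 r0 /andP[d0 d1] gain.
exists alpha, eps; split=> // X Y Z Y0 XS YS Zle.
have YJ k : Y k *m J = G (X k) *m J.
  elim: k => [|k IH]; first by rewrite Y0.
  rewrite YS XS; exact: tracking_mean.
pose V k := fnorm (X k *m J - S) + q * fnorm (X k - X k *m J)
  + r * fnorm (Y k - Y k *m J).
have Vk k : V k <= V 0%N * delta ^+ k.
  elim: k => [|k IH]; first by rewrite expr0 mulr1.
  rewrite exprS mulrCA; apply: (@le_trans _ _ (delta * V k)); last by rewrite ler_pM2l.
  have YJk := YJ k; have Zk := Zle k.
  apply: (gain _ _ _ (fnorm (Y k))); rewrite ?fnorm_ge0//.
  - exact: (tracking_norm_le J_sym J_idem mu0 muL G_lip GSJ YJk).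
  - by rewrite XS; exact: (tracking_optimality J_sym J_idem WJ mu0 muL
      G_mono G_lip SJ GSJ a0 aL YJk Zk).
  - by rewrite XS; exact: (tracking_consensus J_sym J_idem WJ JW W_contr (X k) a0 Zk).
  - rewrite YS XS.
    exact: (tracking_gradient J_sym J_idem WJ JW W_le W_contr mu0 muL
      G_lip (X k) a0 e1 Zk).
have V0 : 0 <= V 0%N by rewrite /V !addr_ge0 ?mulr_ge0 ?fnorm_ge0 ?ltW.
(* The distance to [S] is at most optimality plus consensus error, hence at most [(1 + q^-1) * V k];
   the summand 1 keeps the constant positive when [V 0] is zero. *)
exists ((1 + q^-1) * V 0%N + 1), delta; split; [|by rewrite d0|move=> k].
  by rewrite ltr_wpDl// mulr_ge0// addr_ge0// invr_ge0 ltW.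
have dk : 0 <= delta ^+ k by rewrite exprn_ge0// ltW.
apply: (@le_trans _ _ ((1 + q^-1) * V k)); last first.
  have : (1 + q^-1) * V k <= (1 + q^-1) * (V 0%N * delta ^+ k).
    by rewrite ler_wpM2l// addr_ge0// invr_ge0 ltW.
  by lra.
apply: le_trans (fnorm_sub_trans (X k *m J) _ _) _.
have qi : 0 <= q^-1 by rewrite invr_ge0 ltW.
have h : q^-1 * (q * fnorm (X k - X k *m J)) = fnorm (X k - X k *m J).
  by rewrite mulKf// gt_eqF.
have := fnorm_ge0 (X k *m J - S); have := fnorm_ge0 (X k - X k *m J).
have := fnorm_ge0 (Y k - Y k *m J) => c1 b1 a1.
have := mulr_ge0 qi a1; have := mulr_ge0 qi (mulr_ge0 (ltW r0) c1).
have := mulr_ge0 (ltW q0) b1; have := mulr_ge0 (ltW r0) c1.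
rewrite /V mulrDl mul1r !mulrDr h; lra.
Qed.

(** * Block vectors as matrices *)

Section Blocks.
Context {R : realType} {n d : nat}.
Implicit Types x y : 'cV[R]_(\sum_(i < n) d).

Definition stack x : 'M[R]_(d, n) := \matrix_(r, i) blk x i r 0.

Lemma col_stack x i : col i (stack x) = blk x i.
Proof. by apply/colP => r; rewrite !mxE. Qed.

Lemma stackD x y : stack (x + y) = stack x + stack y.
Proof. by apply/matrixP => r i; rewrite !mxE. Qed.

Lemma stackB x y : stack (x - y) = stack x - stack y.
Proof. by apply/matrixP => r i; rewrite !mxE. Qed.

Lemma stack0 : stack 0 = 0.
Proof. by apply/matrixP => r i; rewrite !mxE. Qed.

Lemma stack_mxcol (B : 'I_n -> 'cV[R]_d) r i :
  stack (\mxcol_j B j) r i = B i r 0.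
Proof. by rewrite mxE /blk mxcolK. Qed.

Lemma blk_mxcol x : x = \mxcol_i blk x i.
Proof. by rewrite submxcolK. Qed.

Lemma enorm_stack x : enorm x = fnorm (stack x).
Proof.
rewrite /enorm /fnorm; congr Num.sqrt.
rewrite /dotv {1 2}(blk_mxcol x) tr_mxcol mul_mxrow_mxcol summxE fdot_col.
by apply: eq_bigr => i _; rewrite col_stack -dotv_fdot.
Qed.

(** Block [i] of the product combines the blocks of [x] with the coefficients of row [i] of [W]; as
    blocks are columns here, the transpose appears. *)
Lemma stack_kronmx (W : 'M[R]_n) x :
  stack (kronmx W (1%:M : 'M[R]_d) *m x) = stack x *m W^T.
Proof.
apply/matrixP => r i; rewrite [in LHS](blk_mxcol x) mul_mxblock_mxrow stack_mxcol.
rewrite summxE mxE; apply: eq_bigr => j _.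
by rewrite -scalemxAl mul1mx !mxE mulrC.
Qed.

Lemma stack_invmx_step (sigma : 'I_n -> R) x : (forall i, sigma i != 0) ->
  stack (invmx (step_mx sigma) *m x) = \matrix_(r, i) ((sigma i)^-1 * stack x r i).
Proof.
move=> s0; pose y : 'cV[R]_(\sum_(i < n) d) := \mxcol_i ((sigma i)^-1 *: blk x i).
(* [invmx] is the identity function on singular matrices, so invertibility is established first, by
   exhibiting the inverse. *)
have unit_step : step_mx sigma \in @unitmx R (\sum_(i < n) d).
  have : step_mx sigma *m step_mx (fun i => (sigma i)^-1) = 1%:M :> 'M[R]_(\sum_(i < n) d).
    rewrite /step_mx mul_mxdiag_mxblock -[RHS]mxdiagZ; apply/eq_mxblock => i j.
    case: eqVneq => [_|_]; last by rewrite mulmx0.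
    by rewrite !conform_mx_id -scalar_mxM divff.
  by case/mulmx1_unit.
have yx : step_mx sigma *m y = x.
  rewrite mul_mxdiag_mxcol [RHS]blk_mxcol; apply/eq_mxcol => i.
  by rewrite mul_scalar_mx scalerA divff ?scale1r.
rewrite -{1}yx mulKmx//; apply/matrixP => r i.
by rewrite stack_mxcol !mxE.
Qed.

Definition stack_grad (f : 'I_n -> 'cV[R]_d -> R) (X : 'M[R]_(d, n)) :
  'M[R]_(d, n) := \matrix_(r, i) grad (f i) (col i X) r 0.

Lemma col_stack_grad f X i : col i (stack_grad f X) = grad (f i) (col i X).
Proof. by apply/colP => r; rewrite !mxE. Qed.

Lemma blk_basisv i j (r : 'I_d) :
  blk (basisv (@tagnat.Rank n (fun=> d) i r)) j = if j == i then basisv r else 0 :> 'cV[R]_d.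
Proof.
apply/colP => s; rewrite !mxE andbT -val_eqE tagnat.eq_Rank val_eqE.
by case: (eqVneq j i) => [_|_] /=; rewrite ?mxE ?andbT.
Qed.

Lemma stack_grad_separable f x : (forall i z, differentiable (f i) z) ->
  stack (grad (separable_sum f) x) = stack_grad f (stack x).
Proof.
move=> df; apply/matrixP => r i; rewrite [LHS]mxE [RHS]mxE col_stack !mxE.
(* The derivative of the [j]-th summand along [v] is that of [f j] along block [j] of [v]; a basis
   vector in block [i] therefore leaves only the [i]-th term. *)
pose h j (z : 'cV[R]_(\sum_(i < n) d)) := f j (blk z j).
have hE j v : (fun t : R => t^-1 *: ((h j \o shift x) (t *: v) - h j x)) =
    (fun t : R => t^-1 *: ((f j \o shift (blk x j)) (t *: blk v j) - f j (blk x j))).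
  apply/funext => t; rewrite /h /=; congr (_ *: (f j _ - _)).
  by apply/colP => s; rewrite !mxE.
have dh j v : is_derive x v (h j) ('D_(blk v j) (f j) (blk x j)).
  split; last by rewrite /derive hE.
  by rewrite /derivable hE; exact: diff_derivable.
have -> : separable_sum f = \sum_j h j by apply/funext => z; rewrite fct_sumE.
rewrite derive_sum; last by move=> j; case: (dh j (basisv (@tagnat.Rank n (fun=> d) i r))).
transitivity (\sum_j if j == i then 'D_(basisv r) (f j) (blk x j) else 0).
  apply: eq_bigr => j _.
  case: (dh j (basisv (@tagnat.Rank n (fun=> d) i r))) => _ ->; rewrite blk_basisv.
  by case: ifP => // _; rewrite derive0.
by rewrite -big_mkcond big_pred1_eq.
Qed.

End Blocks.

(** * Convergence of DSG *)

Lemma fnorm_sum_le (R : realType) m p (I : finType) (F : I -> 'M[R]_(m, p)) :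
  fnorm (\sum_i F i) <= \sum_i fnorm (F i).
Proof.
elim/big_ind2: _ => [|A a B b hA hB|//]; first by rewrite fnorm0.
exact: le_trans (fnormD _ _) (lerD hA hB).
Qed.

Lemma fdot_suml (R : realType) m p (I : finType) (F : I -> 'M[R]_(m, p)) B :
  fdot (\sum_i F i) B = \sum_i fdot (F i) B.
Proof.
elim/big_ind2: _ => [|A a C c <- <-|//]; [exact: fdot0l | exact: fdotDl].
Qed.

(** * The orthogonal projection onto consensus *)

Section Averaging.
Context {R : realType} {n : nat}.
Hypothesis n_gt0 : (0 < n)%N.

Definition avgmx : 'M[R]_n := const_mx n%:R^-1.

Let n_neq0 : n%:R != 0 :> R.
Proof. by rewrite pnatr_eq0 -lt0n. Qed.

Lemma avgmx_sym : avgmx^T = avgmx.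
Proof. by rewrite trmx_const. Qed.

Lemma mul_avgmxE m (M : 'M[R]_(m, n)) k j :
  (M *m avgmx) k j = (\sum_i M k i) / n%:R.
Proof. by rewrite mxE mulr_suml; apply: eq_bigr => i _; rewrite mxE. Qed.

Lemma mul_avgmx1 (M : 'M[R]_n) :
  (forall i, \sum_j M i j = 1) -> M *m avgmx = avgmx.
Proof.
by move=> M1; apply/matrixP => i j; rewrite mul_avgmxE M1 mul1r mxE.
Qed.

Lemma avgmx_idem : avgmx *m avgmx = avgmx.
Proof.
apply: mul_avgmx1 => i; under eq_bigr do rewrite mxE.
by rewrite sumr_const card_ord -(mulr_natr n%:R^-1 n) mulVf.
Qed.

Lemma mul_avgmx_eq0 m (M : 'M[R]_(m, n)) k :
  M *m avgmx = 0 -> \sum_j M k j = 0.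
Proof.
move=> /matrixP /(_ k (Ordinal n_gt0)); rewrite mul_avgmxE mxE => /eqP.
by rewrite mulf_eq0 invr_eq0 (negPf n_neq0) orbF => /eqP.
Qed.

End Averaging.

Section Objective.
Context {R : realType} {n d : nat}.
Variables (f : 'I_n -> 'cV[R]_d -> R) (mu L : R).
Hypotheses (n_gt0 : (0 < n)%N) (mu_gt0 : 0 < mu) (le_mu_L : mu <= L).
Hypothesis f_C2 : forall i, C2 (f i).
Hypothesis f_hess : forall i x,
  lownerle mu%:M (hess (f i) x) /\ lownerle (hess (f i) x) L%:M.

Let L_gt0 : 0 < L. Proof. exact: lt_le_trans le_mu_L. Qed.

Lemma stack_grad_mono (A B : 'M[R]_(d, n)) :
  mu * fdot (A - B) (A - B) <= fdot (stack_grad f A - stack_grad f B) (A - B).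
Proof.
rewrite !(fdot_col _ (A - B)) mulr_sumr; apply: ler_sum => i _.
have -> : col i (stack_grad f A - stack_grad f B) =
    grad (f i) (col i A) - grad (f i) (col i B).
  by rewrite -!col_stack_grad; apply/colP => r; rewrite !mxE.
have -> : col i A = col i B + col i (A - B).
  by apply/colP => r; rewrite !mxE addrC subrK.
exact: grad_secant_ge (f_C2 i) (f_hess i) _ _.
Qed.

Lemma stack_grad_lipschitz (A B : 'M[R]_(d, n)) :
  fnorm (stack_grad f A - stack_grad f B) <= 2 * L * fnorm (A - B).
Proof.
have L0 : 0 <= 2 * L by rewrite mulr_ge0 ?ltW.
apply: fnorm_scale_le => //; rewrite (fdot_col (A - B)) fdot_col mulr_sumr.
apply: ler_sum => i _; rewrite -!fnorm_sqr -exprMn.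
rewrite ler_pXn2r ?nnegrE ?(mulr_ge0 L0) ?fnorm_ge0//.
have -> : col i (stack_grad f A - stack_grad f B) =
    grad (f i) (col i A) - grad (f i) (col i B).
  by rewrite -!col_stack_grad; apply/colP => r; rewrite !mxE.
have -> : col i (A - B) = col i A - col i B by apply/colP => r; rewrite !mxE.
exact: (grad_lipschitz (f_C2 i) (f_hess i) mu_gt0 L_gt0).
Qed.

(** Existence of a stationary point by contraction instead of compactness: the summed gradient is
    strongly monotone and Lipschitz with [n] times the individual constants. *)
Lemma total_grad_zero : exists y, \sum_i grad (f i) y = 0.
Proof.
have n0 : 0 < n%:R :> R by rewrite ltr0n.
apply: (@strongly_monotone_zero _ _ (fun y => \sum_i grad (f i) y)
  (n%:R * mu) (n%:R * (2 * L))).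
- by rewrite mulr_gt0.
- by rewrite ler_pM2l//; have := L_gt0; move: le_mu_L; lra.
- move=> z w; rewrite -sumrB fdot_suml -mulrA mulr_natl.
  rewrite -[X in _ *+ X]card_ord -sumr_const; apply: ler_sum => i _.
  have {3}-> : z = w + (z - w) by rewrite addrC subrK.
  exact: grad_secant_ge (f_C2 i) (f_hess i) _ _.
- move=> z w; rewrite -sumrB; apply: le_trans (fnorm_sum_le _) _.
  rewrite -mulrA mulr_natl -[X in _ *+ X]card_ord -sumr_const.
  apply: ler_sum => i _.
  exact: (grad_lipschitz (f_C2 i) (f_hess i) mu_gt0 L_gt0).
Qed.

(** At a stationary point the linear terms sum to zero, so they may be inserted into the value at
    [y], and strict convexity compares term by term. *)
Lemma unique_minimizer y : \sum_i grad (f i) y = 0 ->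
  unique (minimizer (fun z => \sum_(i < n) f i z)) y.
Proof.
move=> gy.
have E s : \sum_i f i y = \sum_i (f i y + fdot (grad (f i) y) s).
  by rewrite big_split/= -fdot_suml gy fdot0l addr0.
have lt_y z : z != y -> \sum_i f i y < \sum_i f i z.
  rewrite -subr_eq0 => zy; rewrite (E (z - y)); apply: ltr_sum.
    by apply/hasP; exists (Ordinal n_gt0); rewrite ?mem_index_enum.
  move=> i _; have {2}-> : z = y + (z - y) by rewrite addrC subrK.
  exact: (strict_convexity (f_C2 i) (f_hess i)).
split=> [z|z hz]; first by have [->//|/lt_y/ltW] := eqVneq z y.
by apply/eqP; rewrite eq_sym; apply/negPn/negP => /lt_y; rewrite ltNge hz.
Qed.

End Objective.

(** As [alpha * sigma i] lies between 1 and [1 + eps], the relative error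
    [c i = 1 - (alpha * sigma i)^-1] lies between 0 and [eps]; [Z] is [Y] with column [i] scaled by
    [c i]. *)
Lemma relative_step_error (R : realType) d n (alpha eps : R)
    (sigma : 'I_n -> R) (Y : 'M[R]_(d, n)) :
  0 < alpha -> 0 < eps ->
  (forall i, alpha^-1 <= sigma i <= (1 + eps) * alpha^-1) ->
  exists2 Z : 'M[R]_(d, n), fnorm Z <= eps * fnorm Y &
    \matrix_(r, i) ((sigma i)^-1 * Y r i) = alpha *: (Y - Z).
Proof.
move=> a0 e0 hs; pose c i := 1 - (alpha * sigma i)^-1.
have hc i : 1 <= alpha * sigma i <= 1 + eps.
  have /andP[h1 h2] := hs i; rewrite mulrC -ler_pdivrMr// div1r h1/=.
  by rewrite -ler_pdivlMr.
have c01 i : 0 <= c i <= eps.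
  have /andP[h1 h2] := hc i; have t0 : 0 < alpha * sigma i by lra.
  rewrite /c subr_ge0 invf_le1// h1/= lerBlDr -lerBlDl.
  rewrite -[leRHS]mul1r ler_pdivlMr//; nra.
exists (\matrix_(r, i) (c i * Y r i)).
  apply: fnorm_scale_le; first exact: ltW.
  rewrite !fdot_sum mulr_sumr; apply: ler_sum => r _.
  rewrite mulr_sumr; apply: ler_sum => i _.
  rewrite !mxE mulrACA ler_wpM2r -?expr2 ?sqr_ge0//.
  have /andP[h1 h2] := c01 i.
  by rewrite ler_pXn2r ?nnegrE ?(ltW e0).
apply/matrixP => r i; rewrite !mxE /c.
have /andP[h1 _] := hc i; have t0 : 0 < alpha * sigma i by lra.
have s0 : sigma i != 0 by apply: contraTneq t0 => ->; rewrite mulr0 ltxx.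
by field; rewrite s0 gt_eqF.
Qed.

Theorem theorem4p1 (R : realType) (n d : nat) (n_gt0 : (0 < n)%N)
    (d_gt0 : (0 < d)%N)
    (f : 'I_n -> 'cV[R]_d -> R) (mu L : R)
    (mu_gt0 : 0 < mu) (le_mu_L : mu <= L)
    (f_C2 : forall i, C2 (f i))
    (f_hess : forall i x,
      lownerle mu%:M (hess (f i) x) /\ lownerle (hess (f i) x) L%:M)
    (e : rel 'I_n) (e_sym : symmetric e) (e_irr : irreflexive e)
    (e_conn : forall i j, connect e i j)
    (W : 'M[R]_n) (W_sym : W = W^T) (W_ds : doubly_stochastic W)
    (W_edge : forall i j, e i j -> 0 < W i j)
    (W_nonedge : forall i j, ~~ e i j -> i != j -> W i j = 0)
    (W_diag : forall i, W i i = 1 - \sum_(j in neighbors e i) W i j)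
    (wmin wmax : R) (wmin_gt0 : 0 < wmin) (wmax_lt1 : wmax < 1)
    (W_diag_bnd : forall i, wmin <= W i i <= wmax) :
  exists ystar : 'cV[R]_d,
    unique (minimizer (fun y => \sum_(i < n) f i y)) ystar /\
    exists smin smax : R, 0 < smin < smax /\
      forall (x u : nat -> 'cV[R]_(\sum_(i < n) d)) (sigma : nat -> 'I_n -> R),
        DSG f e W smin smax x u sigma -> R_linear_cvg x (replicate ystar).
Proof.
have [y gy] := total_grad_zero n_gt0 mu_gt0 le_mu_L f_C2 f_hess.
exists y; split; first exact: unique_minimizer mu_gt0 f_C2 f_hess _ gy.
have W_ge i : wmin <= W i i by case/andP: (W_diag_bnd i).
have [rho rho01 W_contr] := mixing_contraction W_sym W_ds wmin_gt0 W_ge W_edge e_conn.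
have [_ W_row W_col] := W_ds.
pose J := @avgmx R n; pose S := stack (replicate (n := n) y).
have S_E r i : S r i = y r 0 by rewrite stack_mxcol.
have WJ : W *m J = J by exact: mul_avgmx1.
have JW : J *m W = J.
  by apply: trmx_inj; rewrite trmx_mul avgmx_sym -W_sym.
have SJ : S *m J = S.
  apply/matrixP => r i; rewrite mul_avgmxE S_E.
  under eq_bigr do rewrite S_E.
  by rewrite sumr_const card_ord -(mulr_natr (y r 0) n) mulfK// pnatr_eq0 -lt0n.
(* The first-order condition at [y], read as a vanishing mean of the local gradients at
   consensus. *)
have GSJ : stack_grad f S *m J = 0.
  apply/matrixP => r i; rewrite mul_avgmxE mxE.
  have -> : \sum_j stack_grad f S r j = (\sum_j grad (f j) y) r 0.
    rewrite summxE; apply: eq_bigr => j _; rewrite mxE.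
    by congr (grad _ _ _ _); apply/colP => k; rewrite mxE S_E.
  by rewrite gy mxE mul0r.
have le_mu_2L : mu <= 2 * L by lra.
have [alpha [eps [a0 e0 rate]]] := tracking_linear_rate rho01 mu_gt0 le_mu_2L
  avgmx_sym (avgmx_idem n_gt0) WJ JW (mixing_le W_sym W_ds (m := d))
  (fun M MJ => W_contr d M (fun k => mul_avgmx_eq0 n_gt0 k MJ))
  (stack_grad_mono f_C2 f_hess)
  (stack_grad_lipschitz mu_gt0 le_mu_L f_C2 f_hess) SJ GSJ.
exists alpha^-1, ((1 + eps) * alpha^-1); split.
  by rewrite invr_gt0 a0 ltr_pMl ?invr_gt0// ltrDl.
move=> x u sigma [u0 xS uS sP _].
have df i z : differentiable (f i) z by case: (f_C2 i).
pose X k := stack (x k); pose Y k := stack_grad f (X k) + stack (u k).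
have /choice[Z ZP] k : exists Z : 'M[R]_(d, n), fnorm Z <= eps * fnorm (Y k) /\
    \matrix_(r, i) ((sigma k i)^-1 * Y k r i) = alpha *: (Y k - Z).
  by have [Z] := relative_step_error (Y k) a0 e0 (sP k); exists Z.
have s0 k i : sigma k i != 0.
  have /andP[h _] := sP k i; apply: lt0r_neq0; apply: lt_le_trans h.
  by rewrite invr_gt0.
have [||k|k|C [delta [C0 d01 h]]] := rate X Y Z.
- by rewrite /Y u0 stack0 addr0.
- move=> k; rewrite /X xS stackB stack_kronmx -W_sym stack_invmx_step//.
  by rewrite -(ZP k).2 stackD stack_grad_separable.
(* Adding the new gradient to the recursion for [u] merges [W u] and [(W - I) grad F] into [W Y]
   minus the old gradient. *)
- rewrite /Y {1}/X uS !(stackD, stackB) mulmxBl mul1mx stackB.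
  rewrite !stack_kronmx -W_sym stack_grad_separable// mulmxDl -/(X k) -/(X k.+1).
  by apply/matrixP => r i; rewrite !mxE; ring.
- by case: (ZP k).
by exists C, delta; split=> // k; rewrite enorm_stack stackB; exact: h.
Qed.
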